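(* Let $(M,d)$ be a complete cone metric space over a real Banach space $E$ with respect to a cone $P\subset E$ with $\operatorname{Int} P\neq\emptyset$, and suppose that $P$ is normal with normal constant $K$. Let $S,T:M\to M$ be a pair of generalized Zamfirescu operators, i.e. there are real numbers $0\le a<1$, $0\le b<1/2$, $0\le c<1/2$ such that for all $x,y\in M$ at least one of the following holds: (i) $d(Sx,Sy)\le a\,d(Tx,Ty)$; (ii) $d(Sx,Sy)\le b\,[d(Sx,Tx)+d(Sy,Ty)]$; (iii) $d(Sx,Sy)\le c\,[d(Sx,Ty)+d(Sy,Tx)]$. Suppose moreover that (a) $T$ is continuous; (b) $S(M)\subset T(M)$; (c) $S$ and $T$ commute, i.e. $STx=TSx$ for all $x\in M$. Then $S$ and $T$ have a unique common fixed point, i.e. there is exactly one $z\in M$ with $Sz=Tz=z$.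
   Context: Let $(E,\|\cdot\|)$ be a real Banach space. A subset $P\subset E$ is a cone if: $P$ is closed, nonempty and $P\neq\{0\}$; $ax+by\in P$ for all $x,y\in P$ and all real $a,b\ge 0$; and $P\cap(-P)=\{0\}$. A cone $P$ induces the partial order $x\le y\iff y-x\in P$ on $E$; $x<y$ means $x\le y$ and $x\ne y$; $x\ll y$ means $y-x\in\operatorname{Int}P$, the interior of $P$. It is always assumed that $\operatorname{Int}P\neq\emptyset$. The cone $P$ is normal if there is $K>0$ such that $0\le x\le y$ implies $\|x\|\le K\|y\|$ for all $x,y\in E$; the least such positive $K$ is the normal constant of $P$. A cone metric space (over $E$, $P$) is a nonempty set $M$ with a map $d:M\times M\to E$ such that for all $x,y,z\in M$: $0\le d(x,y)$, with $d(x,y)=0$ iff $x=y$; $d(x,y)=d(y,x)$; $d(x,y)\le d(x,z)+d(z,y)$. A sequence $(x_n)$ in $M$ converges to $x\in M$ if for every $c\in E$ with $0\ll c$ there is $n_0$ such that $d(x_n,x)\ll c$ for all $n\ge n_0$; it is Cauchy if for every $c\in E$ with $0\ll c$ there is $n_0$ such that $d(x_n,x_m)\ll c$ for all $n,m\ge n_0$. $(M,d)$ is complete if every Cauchy sequence converges in $M$. Continuity of maps $M\to M$ is with respect to the topology on $M$ having as sub-basis the sets $B(b,c)=\{y\in M: d(y,b)\ll c\}$, with $b\in M$ and $0\ll c$. *)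

(* Defs.v *)
From HB Require Import structures.
From mathcomp Require Import all_boot all_order all_algebra.
From mathcomp Require Import all_classical all_reals all_analysis.

Set Implicit Arguments.
Unset Strict Implicit.
Unset Printing Implicit Defensive.

Import Order.TTheory GRing.Theory Num.Theory.
Import numFieldNormedType.Exports.

Local Open Scope classical_set_scope.
Local Open Scope ring_scope.

Section Cones.
Context (R : realType) (E : completeNormedModType R).
Implicit Types (P : set E) (x y : E).

Definition is_cone P : Prop :=
  [/\ closed P, P !=set0, P <> [set 0],
      (forall x y (a b : R), P x -> P y -> 0 <= a -> 0 <= b ->
         P (a *: x + b *: y))
    & P `&` [set x | P (- x)] = [set 0]].

Definition cone_le P x y : Prop := P (y - x).

Definition cone_ll P x y : Prop := interior P (y - x).

Definition normal_bound P (K : R) : Prop :=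
  0 < K /\
  forall x y, cone_le P 0 x -> cone_le P x y -> `|x| <= K * `|y|.

Definition normal_cone P : Prop := exists K : R, normal_bound P K.

Definition is_normal_constant P (K : R) : Prop :=
  normal_bound P K /\ forall K' : R, normal_bound P K' -> K <= K'.

End Cones.

Section ConeMetric.
Context (R : realType) (E : completeNormedModType R) (P : set E).
Context (M : Type) (d : M -> M -> E).

Definition is_cone_metric : Prop :=
  [/\ inhabited M,
      (forall x y, cone_le P 0 (d x y)),
      (forall x y, d x y = 0 <-> x = y),
      (forall x y, d x y = d y x)
    & (forall x y z, cone_le P (d x y) (d x z + d z y))].

Definition cone_cvg (u : nat -> M) (x : M) : Prop :=
  forall c : E, cone_ll P 0 c ->
    exists n0 : nat, forall n : nat, (n0 <= n)%N -> cone_ll P (d (u n) x) c.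

Definition cone_cauchy (u : nat -> M) : Prop :=
  forall c : E, cone_ll P 0 c ->
    exists n0 : nat, forall n m : nat, (n0 <= n)%N -> (n0 <= m)%N ->
      cone_ll P (d (u n) (u m)) c.

Definition cone_complete : Prop :=
  forall u : nat -> M, cone_cauchy u -> exists x : M, cone_cvg u x.

Definition cone_ball (b : M) (c : E) : set M := [set y | cone_ll P (d y b) c].

Definition cone_subbase : set (set M) :=
  [set B | exists (b : M) (c : E), cone_ll P 0 c /\ B = cone_ball b c].

Definition generalized_zamfirescu (S T : M -> M) : Prop :=
  exists a b c : R,
    [/\ 0 <= a < 1, 0 <= b < 2^-1, 0 <= c < 2^-1 &
      forall x y : M,
        [\/ cone_le P (d (S x) (S y)) (a *: d (T x) (T y)),
            cone_le P (d (S x) (S y)) (b *: (d (S x) (T x) + d (S y) (T y)))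
          | cone_le P (d (S x) (S y)) (c *: (d (S x) (T y) + d (S y) (T x)))]].

End ConeMetric.

(* A copy of M carrying the topology with sub-basis [cone_subbase P d]; the
   sub-basis is indexed by itself. *)
Definition cone_space (R : realType) (E : completeNormedModType R) (P : set E)
  (M : Type) (d : M -> M -> E) : Type := M.

Section ConeSpace.
Context (R : realType) (E : completeNormedModType R) (P : set E).
Context (M : Type) (d : M -> M -> E).

HB.instance Definition _ := gen_eqMixin (cone_space P d).
HB.instance Definition _ := gen_choiceMixin (cone_space P d).
HB.instance Definition _ := isSubBaseTopological.Build (cone_space P d)
  (cone_subbase P d : set (set (cone_space P d))) id.

End ConeSpace.

(* Main.v *)
Require Import Defs.
From mathcomp Require Import all_boot all_order all_algebra.
From mathcomp Require Import all_classical all_reals all_analysis.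
From mathcomp Require Import ring lra.

(** Choosing [x_(n+1)] with [T x_(n+1) = S x_n], each of the three alternatives
    makes [y_n = S x_n] contract by a fixed factor [h < 1], so [y_n] converges
    to some [z].  Commutation gives [S y_n = T y_(n+1)], so continuity of [T]
    alone sends both [S y_n] and [T y_n] to [T z]; comparing [S y_n] with [S z]
    yields [S z = T z].  The operators separate coincidence values: [S x = T x]
    and [S y = T y] force [S x = S y].  As [S z] is again a coincidence point,
    it is the common fixed point, and it is unique. *)

Import Order.TTheory GRing.Theory Num.Theory.
Import numFieldNormedType.Exports.

Local Open Scope classical_set_scope.
Local Open Scope ring_scope.

(** * Order and interior of a cone *)

Section ConeOrder.
Context {R : realType} {E : completeNormedModType R} {P : set E}.
Context (P_cone : is_cone P).
Implicit Types (u v w x y z c : E) (t s : R).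

Local Notation "x <=: y" := (cone_le P x y) (at level 70).
Local Notation "x <<: y" := (cone_ll P x y) (at level 70).

Lemma cone_comb t s x y : P x -> P y -> 0 <= t -> 0 <= s -> P (t *: x + s *: y).
Proof. by move=> Px Py t0 s0; case: P_cone => _ _ _ + _; exact. Qed.

Lemma coneD x y : P x -> P y -> P (x + y).
Proof. by move=> Px Py; have := @cone_comb 1 1 x y Px Py ler01 ler01; rewrite !scale1r. Qed.

Lemma coneZ t x : 0 <= t -> P x -> P (t *: x).
Proof. by move=> t0 Px; have := @cone_comb t 0 x x Px Px t0 (lexx 0); rewrite scale0r addr0. Qed.

Lemma cone0 : P 0.
Proof. by case: P_cone => _ [x Px] _ _ _; rewrite -(scale0r x); exact: coneZ. Qed.

Lemma cone_ge0 x : (0 <=: x) = P x.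
Proof. by rewrite /cone_le subr0. Qed.

Lemma cone_gg0 x : (0 <<: x) = interior P x.
Proof. by rewrite /cone_ll subr0. Qed.

Lemma cone_le_refl x : x <=: x.
Proof. by rewrite /cone_le subrr; exact: cone0. Qed.

Lemma cone_le_trans y x z : x <=: y -> y <=: z -> x <=: z.
Proof. by move=> xy yz; have := coneD _ _ yz xy; rewrite addrA subrK. Qed.

Lemma cone_le0_eq0 x : 0 <=: x -> x <=: 0 -> x = 0.
Proof.
rewrite cone_ge0 /cone_le sub0r => Px PNx.
by case: P_cone => _ _ _ _ /seteqP[/(_ x) + _]; exact.
Qed.

Lemma cone_leD x y z w : x <=: y -> z <=: w -> x + z <=: y + w.
Proof. by move=> xy zw; rewrite /cone_le opprD addrACA; exact: coneD. Qed.

Lemma cone_leZ t x y : 0 <= t -> x <=: y -> t *: x <=: t *: y.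
Proof. by move=> t0 xy; rewrite /cone_le -scalerBr; exact: coneZ. Qed.

Lemma cone_leZl t s x : t <= s -> 0 <=: x -> t *: x <=: s *: x.
Proof.
by move=> ts x0; rewrite /cone_le -scalerBl; apply: coneZ;
  rewrite ?subr_ge0 -?cone_ge0.
Qed.

(** Solves for a distance that an alternative bounds partly by itself: the term [t *: x] moves to
    the left, where [1 - t] is positive. *)
Lemma cone_le_absorb t x y : t < 1 -> x <=: t *: x + y -> x <=: (1 - t)^-1 *: y.
Proof.
move=> t1 xy; have t1' : 0 < 1 - t by rewrite subr_gt0.
rewrite -[x in x <=: _](scalerK (lt0r_neq0 t1')).
apply: cone_leZ; first by rewrite invr_ge0 ltW.
by rewrite /cone_le scalerBl scale1r opprB addrA (addrC y).
Qed.

Lemma cone_le_contract0 t x : t < 1 -> 0 <=: x -> x <=: t *: x -> x = 0.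
Proof.
move=> t1 x0 xt; apply: cone_le0_eq0 => //.
by rewrite -(scaler0 _ (1 - t)^-1); apply: cone_le_absorb; rewrite ?addr0.
Qed.

Lemma cone_ll_le x y : x <<: y -> x <=: y.
Proof. exact: interior_subset. Qed.

(** Adding an element of [P] keeps interior points interior: for [w] near [z - x], [w - (y - x)] is
    near [z - y], hence in [P], and adding [y - x] stays in [P]. *)
Lemma cone_le_ll_trans y x z : x <=: y -> y <<: z -> x <<: z.
Proof.
move=> xy yz; rewrite /cone_ll /interior /=.
have /= : nbhs (z - x - (y - x)) P by rewrite opprB addrA subrK.
have cst : w - (y - x) @[w --> z - x] --> z - x - (y - x).
  exact: (cvgB cvg_id (cvg_cst _)).
move=> /cst near_P; apply: (@filterS _ (nbhs (z - x)) _ _ _ _ near_P) => w Pw.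
by rewrite -(subrK (y - x) w); exact: coneD.
Qed.

Lemma cone_llZ t c : 0 < t -> 0 <<: c -> 0 <<: t *: c.
Proof.
rewrite !cone_gg0 /interior /= => t0 c0.
have /= : nbhs (t^-1 *: (t *: c)) P by rewrite scalerK ?gt_eqF.
have cst : t^-1 *: w @[w --> t *: c] --> t^-1 *: (t *: c).
  by apply: cvgZl_tmp; exact: cvg_id.
move=> /cst near_P; apply: (@filterS _ (nbhs (t *: c)) _ _ _ _ near_P) => w Pw.
by rewrite -(scalerKV (lt0r_neq0 t0) w); apply: coneZ => //; exact: ltW.
Qed.

Lemma cone_ll_vanish (r : nat -> R) x c : r n @[n --> \oo] --> (0 : R) -> 0 <<: c ->
  exists n0 : nat, forall n : nat, (n0 <= n)%N -> r n *: x <<: c.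
Proof.
move=> r0; rewrite cone_gg0 => c0.
have rc : c - r n *: x @[n --> \oo] --> c.
  rewrite -[X in _ --> X](subr0 c) -(scale0r x).
  by apply: cvgB; [exact: cvg_cst|apply: cvgZr_tmp].
have [|n0 _ n0P] := rc (interior P); last by exists n0 => n /n0P.
by apply: open_nbhs_nbhs; split; [exact: open_interior|].
Qed.

(** For interior [e], the vectors [e / (n + 1) - x] lie in [P] and tend to [- x]; closedness puts
    [- x] in [P]. *)
Lemma cone_le_small_eq0 x : interior P !=set0 -> 0 <=: x ->
  (forall c, 0 <<: c -> x <=: c) -> x = 0.
Proof.
move=> [e Pe] x0 xc; apply: cone_le0_eq0 => //.
rewrite /cone_le -(scale0r e).
case: P_cone => P_closed _ _ _ _.
apply: (@closed_cvg _ _ \oo _ (fun n : nat => n.+1%:R^-1 *: e - x)) => //.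
  apply: nearW => n; apply: xc; apply: cone_llZ; rewrite ?cone_gg0 //.
by apply: cvgB (cvg_cst _); apply: cvgZr_tmp; exact: cvg_harmonic.
Qed.

End ConeOrder.

(** * Cone metrics: topology, Cauchy sequences, Zamfirescu pairs *)

Section ConeMetricSpace.
Context {R : realType} {E : completeNormedModType R} {P : set E}.
Context {M : Type} {d : M -> M -> E}.
Context (P_cone : is_cone P).
Context (d_metric : is_cone_metric P d).
Implicit Types (x y z : M).

Local Notation "x <=: y" := (cone_le P x y) (at level 70).
Local Notation "x <<: y" := (cone_ll P x y) (at level 70).

Lemma cone_dist_ge0 x y : 0 <=: d x y.
Proof. by case: d_metric. Qed.

Lemma cone_dist_eq0 x y : d x y = 0 -> x = y.
Proof. by case: d_metric => _ _ /(_ x y)[]. Qed.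

Lemma cone_distxx x : d x x = 0.
Proof. by case: d_metric => _ _ /(_ x x)[_ ->]. Qed.

Lemma cone_distC x y : d x y = d y x.
Proof. by case: d_metric. Qed.

Lemma cone_dist_triangle y x z : d x z <=: d x y + d y z.
Proof. by case: d_metric => _ _ _ _; exact. Qed.

Lemma cone_ball_open x c : 0 <<: c -> open (cone_ball P d x c : set (cone_space P d)).
Proof.
move=> c0; exists [set cone_ball P d x c]; last by rewrite bigcup_set1.
by move=> _ ->; apply: (@finI_from1 _ _ _ id); exists x, c.
Qed.

(** Links order convergence to the topology, so that continuity of [T] can be applied to sequences.
    It suffices to treat the finitely many sub-basic balls around [x]. *)
Lemma cone_cvg_nbhs (u : nat -> cone_space P d) x :
  cone_cvg P d u x -> u @ \oo --> (x : cone_space P d).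
Proof.
move=> ux A; rewrite nbhsE => -[B [oB Bx] BA]; apply: filterS BA _.
case: oB Bx => D D_sub <- [C DC Cx].
suff : (u @ \oo) C by apply: filterS => y Cy; exists C.
have [F F_sub FC] := D_sub _ DC.
rewrite -FC in Cx *; apply: filter_bigI => G GF.
have [b [c [c0 defG]]] := set_mem (F_sub _ GF).
have : G x by apply: Cx.
rewrite defG /cone_ball /= => xb.
(* As [x] lies in the ball, [c - d x b] is interior and serves as a radius around [x]. *)
have [|n0 n0P] := ux (c - d x b); first by rewrite /cone_ll subr0.
exists n0 => // n /= /n0P unx.
apply: (cone_le_ll_trans P_cone _ _ _ (cone_dist_triangle x _ _)).
by move: unx; rewrite /cone_ll opprD addrA addrAC.
Qed.

Lemma cone_cvg_continuous (f : M -> M) (u : nat -> M) x :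
  continuous (f : cone_space P d -> cone_space P d) ->
  cone_cvg P d u x -> cone_cvg P d (f \o u) (f x).
Proof.
move=> fc /cone_cvg_nbhs ux c c0.
have fux := cvg_comp _ _ ux (fc x).
have [|n0 _ n0P] := fux (cone_ball P d (f x) c); last by exists n0 => n /n0P.
apply: open_nbhs_nbhs; split; first exact: cone_ball_open.
by rewrite /cone_ball /= cone_distxx.
Qed.

Lemma geometric_cone_cauchy (u : nat -> M) (h : R) : 0 <= h < 1 ->
  (forall n, d (u n.+1) (u n.+2) <=: h *: d (u n) (u n.+1)) ->
  cone_cauchy P d u.
Proof.
move=> /andP[h0 h1] uh; set d0 := d (u 0%N) (u 1%N).
have h1' : 1 - h != 0 by rewrite lt0r_neq0 ?subr_gt0.
have step n : d (u n) (u n.+1) <=: h ^+ n *: d0.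
  elim: n => [|n IHn]; first by rewrite expr0 scale1r; exact: cone_le_refl.
  apply: (cone_le_trans P_cone _ _ _ (uh n)).
  by rewrite exprS -scalerA; exact: cone_leZ.
(* The geometric tail bound does not depend on [k], which lets the induction on [k] close with [n]
   varying. *)
have tail k n : d (u n) (u (n + k)%N) <=: (h ^+ n / (1 - h)) *: d0.
  elim: k n => [|k IHk] n.
    rewrite addn0 cone_distxx -(scale0r d0); apply: cone_leZl => //.
      by rewrite divr_ge0 ?exprn_ge0 // subr_ge0 ltW.
    exact: cone_dist_ge0.
  apply: (cone_le_trans P_cone _ _ _ (cone_dist_triangle (u n.+1) _ _)).
  rewrite -addSnnS.
  have -> : h ^+ n / (1 - h) = h ^+ n + h ^+ n.+1 / (1 - h).
    by rewrite -{2}(mulfK h1' (h ^+ n)) -mulrDl mulrBr mulr1 exprSr subrK.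
  by rewrite scalerDl; exact: cone_leD.
move=> c c0.
have [|n0 n0P] := cone_ll_vanish (fun n => h ^+ n / (1 - h)) d0 _ _ c0.
  rewrite -(mul0r (1 - h)^-1); apply: cvgMr_tmp; apply: cvg_expr.
  by rewrite ger0_norm.
exists n0 => n m; wlog nm : n m / (n <= m)%N => [IH n0n n0m|n0n _].
  by case: (leqP n m) => [|/ltnW] /IH; rewrite 1?cone_distC; apply.
apply: (cone_le_ll_trans P_cone _ _ _ _ (n0P _ n0n)).
by have := tail (m - n)%N n; rewrite subnKC.
Qed.

Lemma half_ratio_bounds (b : R) : 0 <= b < 2^-1 -> 0 <= (1 - b)^-1 * b < 1.
Proof.
move=> /andP[b0 b2]; have b1 : 0 < 1 - b by lra.
by rewrite mulrC divr_ge0 ?(ltW b1) //= ltr_pdivrMr // mul1r; lra.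
Qed.

Section Zamfirescu.
Context {S T : M -> M}.
Context (ST_zamfirescu : generalized_zamfirescu P d S T).

Lemma zamfirescu_contraction : exists2 h : R, 0 <= h < 1 &
  forall x y, T y = S x -> d (S x) (S y) <=: h *: d (T x) (T y).
Proof.
case: ST_zamfirescu => a [b [c [a01 b01 c01 STP]]].
have hb := half_ratio_bounds _ b01; have hc := half_ratio_bounds _ c01.
have {}b01 : b < 1 by lra.
have c02 : 0 <= c /\ c < 1 by lra.
(* The factors [b / (1 - b)] and [c / (1 - c)] come from absorbing [d (S x) (S y)] in alternatives
   (ii) and (iii); they are below 1 because [b] and [c] are below 1/2. *)
set h := Num.max a (Num.max ((1 - b)^-1 * b) ((1 - c)^-1 * c)).
have h01 : 0 <= h < 1.
  rewrite /h !gt_max !le_max.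
  by case/andP: a01 => -> ->; case/andP: hb => _ ->; case/andP: hc => _ ->.
exists h => // x y TySx; rewrite TySx.
have weaken t : t <= h -> d (S x) (S y) <=: t *: d (T x) (S x) ->
    d (S x) (S y) <=: h *: d (T x) (S x).
  move=> th /(cone_le_trans P_cone); apply; apply: (cone_leZl P_cone) => //.
  exact: cone_dist_ge0.
have [] := STP x y; rewrite TySx.
- by apply: weaken; rewrite /h le_max lexx.
- rewrite (cone_distC (S x) (T x)) (cone_distC (S y)) scalerDr addrC => le_b.
  apply: (weaken ((1 - b)^-1 * b)); first by rewrite /h !le_max lexx orbT.
  by rewrite -scalerA; exact: cone_le_absorb.
(* Here [d (S x) (T y)] vanishes, and [d (S y) (T x)] is split through [S x]. *)
- rewrite cone_distxx add0r => le_c.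
  apply: (weaken ((1 - c)^-1 * c)); first by rewrite /h !le_max lexx !orbT.
  rewrite -scalerA; apply: cone_le_absorb => //; first by case: c02.
  apply: (cone_le_trans P_cone _ _ _ le_c).
  rewrite -scalerDr addrC (cone_distC (S y)); apply: cone_leZ => //.
    by case: c02.
  exact: cone_dist_triangle.
Qed.

(** At coincidence points the alternatives bound [d (S x) (S y)] by [a], 0 or [2 * c] times itself,
    all factors below 1. *)
Lemma zamfirescu_coincidence x y : S x = T x -> S y = T y -> S x = S y.
Proof.
case: ST_zamfirescu => a [b [c [a01 b01 c01 STP]]] Sx Sy.
apply: cone_dist_eq0; have d0 := cone_dist_ge0 (S x) (S y).
have [] := STP x y; rewrite -Sx -Sy.
- by apply: cone_le_contract0 => //; case/andP: a01.
- rewrite !cone_distxx addr0 scaler0 => le0.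
  exact: (cone_le0_eq0 P_cone).
- rewrite (cone_distC (S y)) -mulr2n -scaler_nat scalerA.
  by apply: cone_le_contract0 => //; lra.
Qed.

Lemma zamfirescu_limit (u : nat -> M) z : interior P !=set0 ->
  cone_cvg P d (T \o u) (T z) -> cone_cvg P d (S \o u) (T z) -> S z = T z.
Proof.
move=> P_int Tu Su; apply: cone_dist_eq0.
apply: (cone_le_small_eq0 P_cone) => // [|e e0]; first exact: cone_dist_ge0.
have d0 := cone_dist_ge0 (S z) (T z).
(* With [D = d (S z) (T z)] and [f = e / 4], the aim is [D <= D / 2 + 2 f], which gives
   [D <= 4 f = e]. *)
have e4 : 0 <<: 4^-1 *: e by apply: (cone_llZ P_cone) => //; rewrite invr_gt0.
have [[n1 n1P] [n2 n2P]] := (Tu _ e4, Su _ e4).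
have /cone_ll_le := n1P _ (leq_maxl n1 n2); have /cone_ll_le := n2P _ (leq_maxr n1 n2).
rewrite /=; move: (u _) (4^-1 *: e) (scalerA 4 4^-1 e) => v f.
rewrite mulfV ?scale1r // => <- Sv Tv.
have halfD (w : E) : w = 2^-1 *: (w + w).
  by rewrite scalerDr -scalerDl (_ : 2^-1 + 2^-1 = 1 :> R) ?scale1r //; field.
(* A common bound for all three alternatives: [d (T v) (T z)] is at most [f], and each bracket in
   (ii) and (iii) is at most [D + 2 f]. *)
suff SvSz : d (S v) (S z) <=: 2^-1 *: (d (S z) (T z) + (f + f)).
  rewrite (_ : 4 *: f = (1 - 2^-1)^-1 *: (f + f)); last first.
    by rewrite [in LHS](halfD f) scalerA; congr (_ *: _); field.
  apply: (cone_le_absorb P_cone); first by lra.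
  apply: (cone_le_trans P_cone _ _ _ (cone_dist_triangle (S v) _ _)).
  rewrite [X in _ + (X + f)](halfD f) addrA -scalerDr (cone_distC (S z)); exact: cone_leD.
have half (t : R) (w w' : E) : 0 <= t < 2^-1 -> 0 <=: w -> w <=: w' ->
    d (S v) (S z) <=: t *: w -> d (S v) (S z) <=: 2^-1 *: w'.
  move=> /andP[t0 t2] w0 ww' /(cone_le_trans P_cone); apply.
  apply: (cone_le_trans P_cone (2^-1 *: w)); first by apply: cone_leZl => //; lra.
  by apply: cone_leZ.
have D0 x y x' y' : 0 <=: d x y + d x' y'.
  by rewrite -(addr0 0); apply: cone_leD => //; exact: cone_dist_ge0.
case: ST_zamfirescu => a [b [c [a01 b01 c01 STP]]].
have [SvP|SvP|SvP] := STP v z.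
- apply: (cone_le_trans P_cone _ _ _ SvP).
  apply: (cone_le_trans P_cone (1 *: d (T v) (T z))).
    by apply: cone_leZl => //; [lra|exact: cone_dist_ge0].
  rewrite scale1r [X in X <=: _]halfD -[X in _ *: X <=: _]add0r.
  by apply: cone_leZ => //; do ?apply: cone_leD => //.
- apply: half SvP => //; rewrite addrC; apply: cone_leD => //.
    exact: cone_le_refl.
  apply: (cone_le_trans P_cone _ _ _ (cone_dist_triangle (T z) _ _)).
  by apply: cone_leD => //; rewrite cone_distC.
- apply: half SvP => //; rewrite addrCA; apply: cone_leD => //.
  apply: (cone_le_trans P_cone _ _ _ (cone_dist_triangle (T z) _ _)).
  by apply: cone_leD => //; [exact: cone_le_refl|rewrite cone_distC].
Qed.

End Zamfirescu.

End ConeMetricSpace.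

Theorem theorem3p2 (R : realType) (E : completeNormedModType R) (P : set E)
    (K : R) (M : Type) (d : M -> M -> E) (S T : M -> M)
    (P_cone : is_cone P)
    (P_int : interior P !=set0)
    (P_normal : normal_cone P)
    (K_normal : is_normal_constant P K)
    (d_metric : is_cone_metric P d)
    (M_complete : cone_complete P d)
    (ST_zamfirescu : generalized_zamfirescu P d S T)
    (T_continuous : continuous (T : cone_space P d -> cone_space P d))
    (S_sub_T : range S `<=` range T)
    (ST_commute : forall x : M, S (T x) = T (S x)) :
  exists! z : M, S z = z /\ T z = z.
Proof.
have [[x0] _ _ _ _] := d_metric.
have /choice[g gP] : forall x, exists y, T y = S x.
  by move=> x; have [|y _ <-] := S_sub_T (S x); [exists x|exists y].
have [h h01 hP] := zamfirescu_contraction P_cone d_metric ST_zamfirescu.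
(* With [x_n = iter n g x0], the choice of [g] gives [y n = S x_n = T x_(n+1)]. *)
pose y n := S (iter n g x0).
have [z yz] : exists z, cone_cvg P d y z.
  apply: M_complete; apply: (geometric_cone_cauchy P_cone d_metric _ _ h01) => n.
  by have := hP _ _ (gP (iter n.+1 g x0)); rewrite /= !gP.
have Ty : cone_cvg P d (T \o y) (T z).
  exact: (cone_cvg_continuous P_cone d_metric).
have Sy : cone_cvg P d (S \o y) (T z).
  (* The index shifts by one: [S (y n) = S (T x_(n+1)) = T (S x_(n+1)) = T (y n.+1)]. *)
  move=> c /Ty[n0 n0P]; exists n0 => n /leqW /n0P.
  by rewrite /y /= -ST_commute gP.
have SzTz := zamfirescu_limit P_cone d_metric ST_zamfirescu _ _ P_int Ty Sy.
have SSz : S (S z) = S z.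
  apply: (zamfirescu_coincidence P_cone d_metric ST_zamfirescu) => //.
  by rewrite {1}SzTz ST_commute.
exists (S z); split; first by split; rewrite // -ST_commute -SzTz.
move=> w [Sw Tw]; rewrite -Sw.
by apply: (zamfirescu_coincidence P_cone d_metric ST_zamfirescu) => //; rewrite Sw Tw.
Qed.
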